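(* Let $G$ be a connected graph of order greater than one, and let $\mathcal{F}(G)$ be the set of all minimum zero forcing sets of $G$. Then $$\bigcap_{Z\in \mathcal{F}(G)} Z=\emptyset .$$
   Context: A graph $G=(V_G,E_G)$ is a finite simple undirected graph with nonempty vertex set; its order is $|V_G|$. Given a coloring of the vertices black or white, the color change rule is: change the color of a white vertex $w$ to black if $w$ is the unique white neighbor of some black vertex $u$ (then $u$ forces $w$, written $u\to w$). The derived set of an initial set of black vertices is the set of black vertices obtained by applying the rule until no more changes are possible. A zero forcing set is a set $Z\subseteq V_G$ such that, if initially exactly the vertices of $Z$ are black, the derived set is $V_G$. The zero forcing number $\mathrm{Z}(G)$ is the minimum of $|Z|$ over all zero forcing sets $Z$. A minimum zero forcing set is a zero forcing set $Z$ with $|Z|=\mathrm{Z}(G)$. *)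

(* Defs.v *)
(* Uses Mathematical Components.  A finite simple graph is given by an edge
   relation [e : rel T] on a vertex type [T : finType], required to be symmetric
   and irreflexive where it is used; its order is [#|T|].  A coloring is the set
   [B : {set T}] of its black vertices. *)
From mathcomp Require Import all_boot.

Set Implicit Arguments.
Unset Strict Implicit.
Unset Printing Implicit Defensive.

Definition connected_graph (T : finType) (e : rel T) : Prop :=
  forall x y : T, connect e x y.

Definition white_neighbors (T : finType) (e : rel T) (B : {set T}) (u : T) :
  {set T} := [set v | e u v & v \notin B].

Definition forces (T : finType) (e : rel T) (B : {set T}) (u w : T) : bool :=
  (u \in B) && (white_neighbors e B u == [set w]).

(* One application of the color change rule, recoloring a single vertex. *)
Definition color_change (T : finType) (e : rel T) : rel {set T} :=
  fun B C => [exists u, exists w, forces e B u w && (C == w |: B)].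

(* [D] results from [Z] by applying the rule until no change is possible; by
   [derived_set_exists] and [derived_set_unique], exactly one [D] does. *)
Definition is_derived_set (T : finType) (e : rel T) (Z D : {set T}) : bool :=
  connect (color_change e) Z D && [forall u, forall w, ~~ forces e D u w].

Definition zero_forcing_set (T : finType) (e : rel T) (Z : {set T}) : bool :=
  is_derived_set e Z [set: T].

(* [setT] serves as the default value: it is a zero forcing set by
   [zero_forcing_setT]. *)
Definition zero_forcing_number (T : finType) (e : rel T) : nat :=
  #|[arg min_(Z < [set: T] | zero_forcing_set e Z) #|Z| ]|.

Definition min_zero_forcing_sets (T : finType) (e : rel T) : {set {set T}} :=
  [set Z | zero_forcing_set e Z & #|Z| == zero_forcing_number e].

Lemma derived_set_exists (T : finType) (e : rel T) (Z : {set T}) :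
  exists D, is_derived_set e Z D.
Proof.
have [n] := ubnP #|~: Z|; elim: n Z => // n IH Z; rewrite ltnS => leZ.
have [|] := boolP [forall u, forall w, ~~ forces e Z u w].
  by move=> stZ; exists Z; rewrite /is_derived_set connect0.
move/forallPn=> [u /forallPn[w]]; rewrite negbK => fuw.
have wZ : w \notin Z.
  have: w \in white_neighbors e Z u by case/andP: fuw => _ /eqP ->; rewrite set11.
  by rewrite inE => /andP[].
have [|D /andP[cD stD]] := IH (w |: Z).
  apply: leq_trans leZ; apply: proper_card.
  by rewrite properC; apply: properUr; rewrite sub1set.
exists D; rewrite /is_derived_set stD andbT; apply: connect_trans cD.
by apply: connect1; apply/existsP; exists u; apply/existsP; exists w; rewrite fuw /=.
Qed.

Lemma derived_set_unique (T : finType) (e : rel T) (Z D1 D2 : {set T}) :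
  is_derived_set e Z D1 -> is_derived_set e Z D2 -> D1 = D2.
Proof.
have sub (B C D : {set T}) : connect (color_change e) B C ->
    [forall u, forall w, ~~ forces e D u w] -> B \subset D -> C \subset D.
  case/connectP=> p pP -> stD; elim: p B pP => //= A p IH B /andP[sBA pP] sBD.
  apply: IH pP _; case/existsP: sBA => u /existsP[w /andP[/andP[uB /eqP Nu]]].
  move=> /eqP->; rewrite subUset sBD andbT sub1set; apply: contraT => wD.
  have /existsP[] := forallP stD u; exists w; rewrite negbK /forces (subsetP sBD) //=.
  rewrite eqEsubset sub1set -{1}Nu inE wD andbT; apply/andP; split.
    apply/subsetP=> v; rewrite !inE => /andP[-> vD] /=.
    by apply: contra vD; apply: (subsetP sBD).
  by have := set11 w; rewrite -Nu inE => /andP[].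
move=> /andP[c1 s1] /andP[c2 s2]; apply/eqP; rewrite eqEsubset.
have subZ (D : {set T}) : connect (color_change e) Z D -> Z \subset D.
  case/connectP=> p pP ->; elim: p Z pP {c1 c2} => //= A p IH B /andP[sBA pP].
  apply: subset_trans (IH _ pP).
  by case/existsP: sBA => u /existsP[w /andP[_ /eqP->]]; apply: subsetUr.
by rewrite (sub _ _ _ c1 s2 (subZ _ c2)) (sub _ _ _ c2 s1 (subZ _ c1)).
Qed.

Lemma zero_forcing_setT (T : finType) (e : rel T) :
  zero_forcing_set e [set: T].
Proof.
rewrite /zero_forcing_set /is_derived_set connect0 /=.
apply/forallP=> u; apply/forallP=> w; apply/negP=> /andP[_ /eqP/setP/(_ w)].
by rewrite !inE andbF eqxx.
Qed.

(* Main.v *)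
(* A run of the color change rule can be reversed: if the vertices of U have
   made the forces, then V \ U has the size of the initial set and is zero
   forcing, each forced vertex forcing its forcer back in the opposite order.
   A vertex v of a minimum zero forcing set Z has a neighbor outside Z:
   otherwise v would force any neighbor x, and Z \ {x} would be zero forcing.
   When the last white neighbor of v is about to be forced, v can force it
   instead, so some run from Z has v in U, and V \ U is a minimum zero forcing
   set that omits v. *)
Require Import Defs.
From mathcomp Require Import all_boot.

Set Implicit Arguments.
Unset Strict Implicit.
Unset Printing Implicit Defensive.

Lemma zero_forcing_setE (T : finType) (e : rel T) (Z : {set T}) :
  zero_forcing_set e Z = connect (color_change e) Z [set: T].
Proof.
rewrite /zero_forcing_set /is_derived_set.
by have /andP[_ ->] := zero_forcing_setT e; rewrite andbT.
Qed.

Lemma forcesP (T : finType) (e : rel T) (B : {set T}) (u w : T) :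
  reflect [/\ u \in B, w \notin B, e u w &
              forall x, e u x -> x \notin B -> x = w]
          (forces e B u w).
Proof.
apply: (iffP andP) => [[uB /eqP/setP Nu]|[uB wB euw Nu]]; split=> //.
- by have := Nu w; rewrite !inE eqxx => /andP[].
- by have := Nu w; rewrite !inE eqxx => /andP[].
- by move=> x eux xB; have := Nu x; rewrite !inE eux xB => /esym/eqP.
apply/eqP/setP=> x; rewrite !inE; apply/andP/eqP=> [[eux xB]|-> //].
exact: Nu.
Qed.

Lemma color_change_forces (T : finType) (e : rel T) (B : {set T}) (u w : T) :
  forces e B u w -> color_change e B (w |: B).
Proof. by move=> fuw; apply/existsP; exists u; apply/existsP; exists w; rewrite fuw /=. Qed.

(* [forcing_run e Z B U]: some sequence of forces leads from the black set [Z]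
   to [B], and [U] is the set of the vertices that made a force. *)
Inductive forcing_run (T : finType) (e : rel T) (Z : {set T}) :
  {set T} -> {set T} -> Prop :=
| forcing_run0 : forcing_run e Z Z set0
| forcing_runS B U u w : forcing_run e Z B U -> forces e B u w ->
    forcing_run e Z (w |: B) (u |: U).

(** A force leaves the forcing vertex without white neighbors, and black vertices never turn white
    again. *)
Lemma forcing_run_black (T : finType) (e : rel T) (Z B U : {set T}) (u : T) :
  forcing_run e Z B U -> u \in U ->
  u \in B /\ (forall x, e u x -> x \in B).
Proof.
elim=> [|{}B {}U u' w _ IH /forcesP[u'B _ _ Nu']]; first by rewrite inE.
rewrite in_setU1 => /predU1P[->|/IH[uB Nu]]; split=> [|x eux];
  rewrite in_setU1 ?u'B ?uB ?Nu ?orbT //.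
by apply/orP; have [|xB] := boolP (x \in B); [right | left; rewrite (Nu' x)].
Qed.

Lemma forcing_run_fresh (T : finType) (e : rel T) (Z B U : {set T}) (u w : T) :
  forcing_run e Z B U -> forces e B u w -> u \notin U.
Proof.
move=> run /forcesP[_ wB euw _]; apply: contra wB => uU.
by have [_] := forcing_run_black run uU; apply.
Qed.

(** Each force adds one vertex to [B] and, as no vertex forces twice, one to [U]. *)
Lemma card_forcing_run (T : finType) (e : rel T) (Z B U : {set T}) :
  forcing_run e Z B U -> #|B| = #|Z| + #|U|.
Proof.
elim=> [|{}B {}U u w run IH fuw]; first by rewrite cards0 addn0.
have /forcesP[_ wB _ _] := fuw.
by rewrite !cardsU1 wB (forcing_run_fresh run fuw) IH addnCA.
Qed.

Lemma forcing_run_reversal (T : finType) (e : rel T) (Z B U : {set T}) :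
  symmetric e -> forcing_run e Z B U -> zero_forcing_set e (~: U).
Proof.
move=> e_sym; rewrite zero_forcing_setE.
elim=> [|{}B {}U u w run IH fuw]; first by rewrite setC0.
(* The last force [u -> w] is undone first: [w] forces [u], which turns [~: (u |: U)] into [~: U],
   where the induction hypothesis takes over. *)
apply: connect_trans IH; apply: connect1.
have uU := forcing_run_fresh run fuw.
have /forcesP[uB wB euw _] := fuw.
have -> : ~: U = u |: ~: (u |: U).
  by apply/setP=> x; rewrite !inE negb_or; case: eqP => // ->.
apply: (@color_change_forces _ _ _ w); apply/forcesP; split.
- rewrite in_setC in_setU1 negb_or; apply/andP; split.
    by apply: contraNneq wB => ->.
  by apply: contra wB => /(forcing_run_black run)[].
- by rewrite in_setC setU11.
- by rewrite e_sym.
move=> x ewx; rewrite in_setC negbK in_setU1 => /predU1P[//|xU].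
(* A neighbor of [w] in [U] would have only black neighbors in [B], but [w] is still white there. *)
by case/negP: wB; have [_] := forcing_run_black run xU; apply; rewrite e_sym.
Qed.

Lemma forcing_run_extend (T : finType) (e : rel T) (Z B C U : {set T}) :
  forcing_run e Z B U -> connect (color_change e) B C ->
  exists2 U', forcing_run e Z C U' & U \subset U'.
Proof.
move=> run /connectP[p pP ->]; elim: p B U run pP => [|A p IH] B U run /=.
  by exists U.
case/andP=> /existsP[u /existsP[w /andP[fuw /eqP->]]] pP.
have [U' runU' sUU'] := IH _ _ (forcing_runS run fuw) pP.
by exists U' => //; apply: subset_trans sUU'; apply: subsetUr.
Qed.

Lemma forcing_run_through (T : finType) (e : rel T) (Z B U : {set T})
    (v x : T) :
  forcing_run e Z B U -> connect (color_change e) B [set: T] ->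
  v \in B -> e v x -> x \notin B ->
  exists2 U', forcing_run e Z [set: T] U' & v \in U'.
Proof.
move=> run /connectP[p]; elim: p B U x run => [|A p IH] B U x run /=.
  by move=> _ <-; rewrite !inE.
case/andP=> /existsP[u /existsP[w /andP[fuw /eqP->]]] pP lastp vB evx xB.
(* If [v] keeps a white neighbor after this force, the induction goes on with it. Otherwise [w] is
   the last white neighbor of [v]. *)
have [y /andP[evy ywB]|Nv] := pickP [pred y | e v y & y \notin w |: B].
  by apply: (IH _ _ _ (forcing_runS run fuw) pP lastp _ evy ywB); rewrite setU1r.
have Nw y : e v y -> y \notin B -> y = w.
  move=> evy yB; have := Nv y; rewrite /= evy in_setU1 (negPf yB) orbF /=.
  by move/negbFE/eqP.
have fvw : forces e B v w.
  have /forcesP[_ wB _ _] := fuw.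
  by apply/forcesP; split=> //; rewrite -(Nw x).
(* Forcing [w] by [v] instead of [u] yields the same black set, so the remaining path [p] still
   applies. *)
have [|U' runU' /subsetP sU'] := forcing_run_extend (forcing_runS run fvw) (C := setT).
  by apply/connectP; exists p.
by exists U' => //; apply: sU'; rewrite setU11.
Qed.

Lemma zero_forcing_number_le (T : finType) (e : rel T) (Z : {set T}) :
  zero_forcing_set e Z -> zero_forcing_number e <= #|Z|.
Proof.
rewrite /zero_forcing_number; case: arg_minnP => [|A _ minA]; last exact: minA.
exact: zero_forcing_setT.
Qed.

Lemma min_zero_forcing_set_exists (T : finType) (e : rel T) :
  exists Z, Z \in min_zero_forcing_sets e.
Proof.
exists [arg min_(Z < [set: T] | zero_forcing_set e Z) #|Z| ].
rewrite inE eqxx andbT; case: arg_minnP => //; exact: zero_forcing_setT.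
Qed.

Lemma connected_graph_neighbor (T : finType) (e : rel T) (v : T) :
  connected_graph e -> 1 < #|T| -> exists x, e v x.
Proof.
move=> e_conn; rewrite (cardD1 v) inE ltnS => /card_gt0P[y /andP[yv _]].
have /connectP[[|x p] /=] := e_conn v y; last by case/andP; exists x.
by move=> _ yE; rewrite yE eqxx in yv.
Qed.

Lemma min_zero_forcing_set_neighbor (T : finType) (e : rel T) (Z : {set T})
    (v : T) :
  irreflexive e -> connected_graph e -> 1 < #|T| ->
  Z \in min_zero_forcing_sets e -> v \in Z -> exists2 x, e v x & x \notin Z.
Proof.
move=> e_irr e_conn T_gt1; rewrite inE => /andP[zfZ /eqP cardZ] vZ.
have [x /andP[evx xZ]|Nv] := pickP [pred x | e v x & x \notin Z].
  by exists x.
have {}Nv y : e v y -> y \in Z by move=> evy; have := Nv y; rewrite /= evy => /negbFE.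
have [x evx] := connected_graph_neighbor v e_conn T_gt1.
have xZ := Nv x evx.
have /zero_forcing_number_le : zero_forcing_set e (Z :\ x).
  rewrite zero_forcing_setE; rewrite zero_forcing_setE in zfZ; apply: connect_trans zfZ; apply: connect1.
  rewrite -{2}(setD1K xZ); apply: (@color_change_forces _ _ _ v).
  apply/forcesP; split=> //.
  - by rewrite in_setD1 vZ andbT; apply/eqP=> vx; rewrite vx e_irr in evx.
  - by rewrite setD11.
  by move=> y /Nv yZ; rewrite in_setD1 yZ andbT negbK => /eqP.
by rewrite -cardZ (cardsD1 x Z) xZ ltnn.
Qed.

Theorem theorem2p9 (T : finType) (e : rel T)
  (e_sym : symmetric e) (e_irr : irreflexive e)
  (e_conn : connected_graph e) (order_gt1 : 1 < #|T|) :
  \bigcap_(Z in min_zero_forcing_sets e) Z = set0.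
Proof.
apply/setP=> v; rewrite [RHS]inE; apply/negP=> /bigcapP vmin.
have [Z Zmin] := min_zero_forcing_set_exists e.
have [x evx xZ] :=
  min_zero_forcing_set_neighbor e_irr e_conn order_gt1 Zmin (vmin Z Zmin).
have := Zmin; rewrite inE zero_forcing_setE => /andP[zfZ /eqP cardZ].
have [U run vU] :=
  forcing_run_through (forcing_run0 e Z) zfZ (vmin Z Zmin) evx xZ.
have /vmin : ~: U \in min_zero_forcing_sets e.
  (* After adding [#|U|], both sizes become [#|T|], since the run ends with all vertices black. *)
  rewrite inE (forcing_run_reversal e_sym run) -cardZ /= -(eqn_add2r #|U|).
  by rewrite -(card_forcing_run run) addnC cardsC cardsT.
by rewrite in_setC vU.
Qed.
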